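(* Let $\mathbf f\in\Omega_{\mathbf f}$, $\boldsymbol\xi\in\widetilde\Omega_{\boldsymbol\xi}(\mathbf f)$ and $\mathbf s^l\in\widetilde\Omega_{\mathbf s^l}(\boldsymbol\xi,\mathbf f)$, and let $\mathcal S_{\rm G}\subseteq\mathcal V_{\rm G}$ and $\mathcal S_{\rm B}\subseteq\mathcal E$ be the sets of generators and branches corresponding to the binding inequality constraints at the optimal solution of the DC-OPF problem with data $(\mathbf f,\boldsymbol\xi,\mathbf s^l)$. Suppose $\mathcal S_{\rm B}$ partitions $\mathcal G$ into $m$ disjoint subgraphs $\{\mathcal G_i(\mathcal V_i,\mathcal E_i)\}_{i=1}^m$, where $\bigcup_i\mathcal V_i=\mathcal V$ and $(\bigcup_i\mathcal E_i)\cup\mathcal S_{\rm B}=\mathcal E$. Then for every $i\in\{1,\dots,m\}$, $$\mathcal S_{\rm G}^{\mathsf c}\cap\mathcal V_i\neq\emptyset,\qquad\text{where } \mathcal S_{\rm G}^{\mathsf c}:=\mathcal V_{\rm G}\setminus\mathcal S_{\rm G}.$$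
   Context: **Network.** $\mathcal G(\mathcal V,\mathcal E)$ is an undirected graph with $N$ vertices and $E$ edges. $\mathcal V=\mathcal V_{\rm G}\cup\mathcal V_{\rm L}$ is a disjoint union of $N_{\rm G}$ generator buses, indexed $1,\dots,N_{\rm G}$, and $N_{\rm L}$ load buses, indexed $N_{\rm G}+1,\dots,N_{\rm G}+N_{\rm L}=N$. $\mathbf C\in\mathbb R^{N\times E}$ is the (oriented) incidence matrix, $\mathbf B=\mathrm{diag}(b_1,\dots,b_E)$ with all $b_e>0$, and $\mathbf L=\mathbf C\mathbf B\mathbf C^{\mathsf T}$. Vertices and edges are identified with their indices. **DC-OPF problem.** Given a cost vector $\mathbf f\in\mathbb R_+^{N_{\rm G}}$, a load vector $\mathbf s^l\in\mathbb R^{N_{\rm L}}$ and limits $\boldsymbol\xi=[(\overline{\mathbf s}^g)^{\mathsf T},(\underline{\mathbf s}^g)^{\mathsf T},\overline{\mathbf p}^{\mathsf T},\underline{\mathbf p}^{\mathsf T}]^{\mathsf T}\in\mathbb R^{2N_{\rm G}+2E}$: $$\min_{\mathbf s^g\in\mathbb R^{N_{\rm G}},\,\boldsymbol\theta\in\mathbb R^N}\ \mathbf f^{\mathsf T}\mathbf s^g\quad\text{s.t.}\quad \boldsymbol\theta_1=0,\quad \mathbf L\boldsymbol\theta=\begin{bmatrix}\mathbf s^g\\-\mathbf s^l\end{bmatrix},\quad \underline{\mathbf s}^g\le\mathbf s^g\le\overline{\mathbf s}^g,\quad \underline{\mathbf p}\le\mathbf B\mathbf C^{\mathsf T}\boldsymbol\theta\le\overline{\mathbf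 p}.$$ Inequalities between vectors are entrywise. An inequality constraint is binding if it holds with equality at the optimum. $\mathcal S_{\rm G}$ is the set of generators for which a generation limit is binding; $\mathcal S_{\rm B}$ is the set of branches for which a flow limit is binding. **Parameter sets.** - $\Omega_{\boldsymbol\xi}$ is the set of $\boldsymbol\xi$ with $\underline{\mathbf s}^g\ge 0$ for which the DC-OPF constraints are feasible for some $\mathbf s^l>0$. - For $\boldsymbol\xi\in\Omega_{\boldsymbol\xi}$, $\Omega_{\mathbf s^l}(\boldsymbol\xi)$ is the set of $\mathbf s^l>0$ for which the DC-OPF constraints are feasible. - $\Omega_{\mathbf f}$ is the set of $\mathbf f\ge 0$ such that for all $\boldsymbol\xi\in\Omega_{\boldsymbol\xi}$ and $\mathbf s^l\in\Omega_{\mathbf s^l}(\boldsymbol\xi)$, the DC-OPF problem has a unique solution and at least $N_{\rm G}-1$ nonzero dual variables (Lagrange multipliers) at the optimal point. - $\widetilde\Omega_{\mathbf s^l}(\boldsymbol\xi,\mathbf f)$ is the set of $\mathbf s^l\in\Omega_{\mathbf s^l}(\boldsymbol\xi)$ for which the DC-OPF problem has exactly $N_{\rm G}-1$ binding inequalities. - For $\mathbf f\in\Omega_{\mathbf f}$, $\widetilde\Omega_{\boldsymbol\xi}(\mathbf f)$ is a (fixed) dense subset of $\Omega_{\boldsymbol\xi}$ such that every $\boldsymbol\xi\in\widetilde\Omega_{\boldsymbol\xi}(\mathbf f)$ satisfies: (1) $\mathrm{clos}(\mathrm{int}(\Omega_{\mathbf s^l}(\boldsymbol\xi)))=\mathrm{clos}(\Omega_{\mathbf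 s^l}(\boldsymbol\xi))$; (2) $\widetilde\Omega_{\mathbf s^l}(\boldsymbol\xi,\mathbf f)$ is dense in $\Omega_{\mathbf s^l}(\boldsymbol\xi)$. For such $\mathbf f,\boldsymbol\xi$, the map from $\mathbf s^l$ to the optimal generation is differentiable at each $\mathbf s^l\in\widetilde\Omega_{\mathbf s^l}(\boldsymbol\xi,\mathbf f)$ and the set of binding constraints is unchanged in some neighborhood of $\mathbf s^l$. **Graph partition.** A set of edges partitions $\mathcal G$ into disjoint subgraphs if removing these edges reduces $\mathcal G$ to those subgraphs as (pairwise disjoint, nonempty) components; in particular, every edge of $\mathcal G$ joining two different $\mathcal V_i$'s belongs to $\mathcal S_{\rm B}$. *)

(* Defs.v *)
From HB Require Import structures.
From mathcomp Require Import all_boot all_order all_algebra.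
From mathcomp Require Import all_classical all_reals all_analysis.
Set Implicit Arguments.
Unset Strict Implicit.
Unset Printing Implicit Defensive.
Import Order.TTheory GRing.Theory Num.Theory.
Import numFieldNormedType.Exports.
Local Open Scope ring_scope.

(* Buses are ['I_(nG + nL)]: [lshift nL g] is generator [g], [rshift nG l] is *)
(* load [l], and the reference bus is the one of value 0.                     *)

(* [src] and [dst] fix the orientation used by the incidence matrix; parallel *)
(* edges are not excluded.                                                    *)
Record network (R : realType) (nG nL nE : nat) := Network {
  src : 'I_nE -> 'I_(nG + nL);
  dst : 'I_nE -> 'I_(nG + nL);
  no_loop : forall e, src e != dst e;
  suscept : 'rV[R]_nE;
  suscept_gt0 : forall e, 0 < suscept 0 e }.

Definition vle (R : realType) (n : nat) (u v : 'cV[R]_n) : Prop :=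
  forall i, u i 0 <= v i 0.

Definition vpos (R : realType) (n : nat) (u : 'cV[R]_n) : Prop :=
  forall i, 0 < u i 0.

Definition dense_in (T : topologicalType) (A B : set T) : Prop :=
  (A `<=` B)%classic /\ (B `<=` closure A)%classic.

(* A vector indexed by the 2 nG + 2 nE inequality constraints, in the order   *)
(* upper generation, lower generation, upper flow, lower flow.  Used for the  *)
(* limits, the slacks and the multipliers.                                    *)
Notation ineq_vec R nG nE := 'cV[R]_((nG + nG) + (nE + nE)).

Section IneqVec.
Variables (R : realType) (nG nE : nat).
Implicit Type x : ineq_vec R nG nE.

Definition gen_up x : 'cV[R]_nG := usubmx (usubmx x).
Definition gen_lo x : 'cV[R]_nG := dsubmx (usubmx x).
Definition flow_up x : 'cV[R]_nE := usubmx (dsubmx x).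
Definition flow_lo x : 'cV[R]_nE := dsubmx (dsubmx x).

End IneqVec.

Section DCOPF.
Variables (R : realType) (nG nL nE : nat) (G : network R nG nL nE).

Implicit Types (f sg : 'cV[R]_nG) (th : 'cV[R]_(nG + nL)) (sl : 'cV[R]_nL).
Implicit Types (xi lam : ineq_vec R nG nE).

Definition incidence : 'M[R]_(nG + nL, nE) :=
  \matrix_(v, e) ((v == src G e)%:R - (v == dst G e)%:R).

Definition Bmx : 'M[R]_nE := diag_mx (suscept G).

Definition laplacian : 'M[R]_(nG + nL) := incidence *m Bmx *m incidence^T.

Definition flow th : 'cV[R]_nE := Bmx *m incidence^T *m th.

Definition feasible xi sl sg th : Prop :=
  [/\ forall v : 'I_(nG + nL), v = 0%N :> nat -> th v 0 = 0,
      laplacian *m th = col_mx sg (- sl),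
      vle (gen_lo xi) sg /\ vle sg (gen_up xi)
    & vle (flow_lo xi) (flow th) /\ vle (flow th) (flow_up xi)].

Definition cost f sg : R := (f^T *m sg) 0 0.

Definition optimal f xi sl sg th : Prop :=
  feasible xi sl sg th /\
  forall sg' th', feasible xi sl sg' th' -> cost f sg <= cost f sg'.

Definition slack xi sg th : ineq_vec R nG nE :=
  col_mx (col_mx (gen_up xi - sg) (sg - gen_lo xi))
         (col_mx (flow_up xi - flow th) (flow th - flow_lo xi)).

Definition binding xi sg th : {set 'I_((nG + nG) + (nE + nE))} :=
  [set k | slack xi sg th k 0 == 0]%SET.

Definition binding_gens xi sg : {set 'I_nG} :=
  [set g | (sg g 0 == gen_up xi g 0) || (sg g 0 == gen_lo xi g 0)]%SET.

Definition binding_branches xi th : {set 'I_nE} :=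
  [set e | (flow th e 0 == flow_up xi e 0)
        || (flow th e 0 == flow_lo xi e 0)]%SET.

(* KKT conditions on the dual variables at (sg, th), for the Lagrangian       *)
(*     f^T sg + a th_1 + tau^T (L th - [sg; - sl])                            *)
(*     + gen_up lam^T (sg - gen_up xi) + gen_lo lam^T (gen_lo xi - sg)        *)
(*     + flow_up lam^T (flow th - flow_up xi)                                 *)
(*     + flow_lo lam^T (flow_lo xi - flow th).                                *)
(* The first two equations are its derivatives in sg and th.                  *)
Definition multipliers f xi sg th
    (a : R) (tau : 'cV[R]_(nG + nL)) lam : Prop :=
  [/\ f - usubmx tau + (gen_up lam - gen_lo lam) = 0,
      a *: (\col_v ((v : nat) == 0%N)%:R) + laplacian^T *m tau
        + (Bmx *m incidence^T)^T *m (flow_up lam - flow_lo lam) = 0,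
      vle 0 lam
    & forall k, lam k 0 * slack xi sg th k 0 = 0].

Definition Omega_sl xi : set 'cV[R]_nL :=
  [set sl | vpos sl /\ exists sg th, feasible xi sl sg th]%classic.

Definition Omega_xi : set (ineq_vec R nG nE) :=
  [set xi | vle 0 (gen_lo xi) /\ exists sl, Omega_sl xi sl]%classic.

Definition nonzero_duals lam : {set 'I_((nG + nG) + (nE + nE))} :=
  [set k | lam k 0 != 0]%SET.

(* The dual variables counted are those of the inequality constraints.  The   *)
(* comparisons with nG - 1, here and in [tilde_Omega_sl], are written         *)
(* additively to avoid truncated subtraction.                                 *)
Definition Omega_f : set 'cV[R]_nG :=
  [set f | vle 0 f /\
    forall xi sl, Omega_xi xi -> Omega_sl xi sl ->
      exists x : 'cV[R]_nG * 'cV[R]_(nG + nL),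
        unique (fun y => optimal f xi sl y.1 y.2) x /\
        exists a tau lam, multipliers f xi x.1 x.2 a tau lam /\
          (nG <= #|nonzero_duals lam|.+1)%N]%classic.

Definition tilde_Omega_sl xi f : set 'cV[R]_nL :=
  [set sl | Omega_sl xi sl /\
    exists sg th, optimal f xi sl sg th /\ #|binding xi sg th|.+1 = nG]%classic.

Definition is_tilde_Omega_xi f (X : set (ineq_vec R nG nE)) : Prop :=
  dense_in X Omega_xi /\
  forall xi, X xi ->
    closure (interior (Omega_sl xi)) = closure (Omega_sl xi) /\
    dense_in (tilde_Omega_sl xi f) (Omega_sl xi).

(* Removing the edges of S leaves exactly the disjoint union of the nonempty  *)
(* subgraphs (V i, Es i).  The subgraphs need not be connected; the connected *)
(* components of the remaining graph are one instance.                        *)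
Definition partitions_graph (S : {set 'I_nE}) (m : nat)
    (V : 'I_m -> {set 'I_(nG + nL)}) (Es : 'I_m -> {set 'I_nE}) : Prop :=
  [/\ (forall i, V i != finset.set0) /\
      (forall i j, i != j -> [disjoint V i & V j]),
      (\bigcup_(i < m) V i = [set: 'I_(nG + nL)])%SET,
      forall i e, e \in Es i -> [&& src G e \in V i, dst G e \in V i & e \notin S]
    & (\bigcup_(i < m) Es i :|: S = [set: 'I_nE])%SET].

End DCOPF.

(* Main.v *)
(* Suppose every generator of V_i is binding.  Count linear functionals of the
   phase angles: the reference angle, the injections at the loads and at the
   binding generators, and the flows on the binding branches are at most
   1 + nL + (nG - 1) = nG + nL of them.  The injections over V_i sum to the net
   flow across its boundary, which consists of binding branches, so the
   injection at one bus of V_i is redundant and some nonzero direction is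
   killed by all of them.  Moving a little both ways along it stays feasible,
   hence does not change the cost, which contradicts uniqueness of the
   optimum. *)
Require Import Defs.
From mathcomp Require Import all_boot all_order all_algebra.
From mathcomp Require Import all_classical all_reals all_analysis.
From mathcomp Require Import lra.
Set Implicit Arguments.
Unset Strict Implicit.
Unset Printing Implicit Defensive.
Import Order.TTheory GRing.Theory Num.Theory.
Import numFieldNormedType.Exports.
Local Open Scope ring_scope.

Lemma exists_common_kernel (F : fieldType) (n : nat) (s : seq 'rV[F]_n) :
  (size s < n)%N ->
  exists2 u : 'cV[F]_n, u != 0 & forall r, r \in s -> r *m u = 0.
Proof.
move=> lt_sn; pose A := \matrix_(i < size s) s`_i.
have /rowV0Pn[w /sub_kermxP wA w_neq0] : kermx A^T != 0.
  rewrite -mxrank_eq0 mxrank_ker mxrank_tr subn_eq0 -ltnNge.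
  exact: leq_ltn_trans (rank_leq_row A) lt_sn.
exists w^T; first by rewrite trmx_eq0.
move=> r /(nthP 0)[i lt_is <-].
have Aw : A *m w^T = 0 by rewrite -[A]trmxK -trmx_mul wA trmx0.
by have := congr1 (row (Ordinal lt_is)) Aw; rewrite row_mul rowK row0.
Qed.

(** A ratio test: [t] is the least [s k / |c k|] over the [k] with [c k != 0]. Each ratio is
    positive because [c] vanishes wherever [s] does. *)
Lemma exists_scaling_le (R : realFieldType) (I : finType) (s c : I -> R) :
  (forall k, 0 <= s k) -> (forall k, s k = 0 -> c k = 0) ->
  exists2 t, 0 < t & forall k, t * `|c k| <= s k.
Proof.
move=> s_ge0 sc0.
(* The default 1 keeps the minimum positive when [c] is identically zero. *)
exists (\big[Num.min/1]_(k | c k != 0) (s k / `|c k|)).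
  apply/bigmin_gtP; split=> [|k ck]; first exact: ltr01.
  rewrite divr_gt0 ?normr_gt0//.
  rewrite lt_neqAle s_ge0 andbT eq_sym.
  by apply: contra_neq ck; exact: sc0.
move=> k; have [->|ck] := eqVneq (c k) 0; first by rewrite normr0 mulr0.
by rewrite -ler_pdivlMr ?normr_gt0//; exact: bigmin_le_cond.
Qed.

Section Perturbation.
Variables (R : realType) (nG nL nE : nat) (G : network R nG nL nE).
Implicit Types (f sg : 'cV[R]_nG) (th u : 'cV[R]_(nG + nL)) (sl : 'cV[R]_nL).
Implicit Types (xi : ineq_vec R nG nE).

(** The linear part of the affine map [slack G xi]. *)
Definition slack_shift (sg : 'cV[R]_nG) (th : 'cV[R]_(nG + nL)) :
    ineq_vec R nG nE :=
  col_mx (col_mx (- sg) sg) (col_mx (- flow G th) (flow G th)).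

Lemma slackDZ xi sg dsg th u t :
  slack G xi (sg + t *: dsg) (th + t *: u)
  = slack G xi sg th + t *: slack_shift dsg u.
Proof.
rewrite /slack /slack_shift /flow mulmxDr -scalemxAr.
rewrite !scale_col_mx !add_col_mx !scalerN !opprD !addrA.
by congr (col_mx (col_mx _ _) (col_mx _ _)); rewrite addrAC.
Qed.

Lemma slackE xi sg th :
  (forall i, slack G xi sg th (lshift _ (lshift _ i)) 0
     = gen_up xi i 0 - sg i 0)
  * (forall i, slack G xi sg th (lshift _ (rshift _ i)) 0
     = sg i 0 - gen_lo xi i 0)
  * (forall i, slack G xi sg th (rshift _ (lshift _ i)) 0
     = flow_up xi i 0 - flow G th i 0)
  * (forall i, slack G xi sg th (rshift _ (rshift _ i)) 0
     = flow G th i 0 - flow_lo xi i 0).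
Proof.
have subE n (A B : 'cV[R]_n) i : (A - B) i 0 = A i 0 - B i 0.
  by rewrite mxE [X in _ + X]mxE.
by split; [split; [split|]|] => i; rewrite /slack !(col_mxEu, col_mxEd) subE.
Qed.

Lemma vle_limits_slack xi sg th :
  ((vle (gen_lo xi) sg /\ vle sg (gen_up xi)) /\
   (vle (flow_lo xi) (flow G th) /\ vle (flow G th) (flow_up xi)))
  <-> forall k, 0 <= slack G xi sg th k 0.
Proof.
split.
  move=> [[h1 h2] [h3 h4]] k.
  by case: (split_ordP k) => j ->; case: (split_ordP j) => i ->;
    rewrite slackE subr_ge0.
move=> h; split; split=> i; rewrite -subr_ge0.
- by have := h (lshift _ (rshift _ i)); rewrite slackE.
- by have := h (lshift _ (lshift _ i)); rewrite slackE.
- by have := h (rshift _ (rshift _ i)); rewrite slackE.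
- by have := h (rshift _ (lshift _ i)); rewrite slackE.
Qed.

(** Only an inequality: when the upper and lower limits coincide, both constraints bind but the
    generator or branch is counted once. *)
Lemma card_binding_ge xi sg th :
  (#|binding_gens xi sg| + #|binding_branches G xi th|
   <= #|binding G xi sg th|)%N.
Proof.
rewrite -!sum1_card [leqRHS]big_mkcond !big_split_ord/= -!big_split/=.
rewrite [X in (X + _ <= _)%N]big_mkcond [X in (_ + X <= _)%N]big_mkcond/=.
apply: leq_add; apply: leq_sum => i _; rewrite !inE !slackE !subr_eq0.
  by rewrite [gen_up _ _ _ == _]eq_sym; do 2 case: eqP.
by rewrite [flow_up _ _ _ == _]eq_sym; do 2 case: eqP.
Qed.

Lemma slack_shift_binding xi sg (dsg : 'cV[R]_nG) th u :
  (forall g, g \in binding_gens xi sg -> dsg g 0 = 0) ->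
  (forall e, e \in binding_branches G xi th -> flow G u e 0 = 0) ->
  forall k, slack G xi sg th k 0 = 0 -> slack_shift dsg u k 0 = 0.
Proof.
move=> hg he k; rewrite /slack_shift.
case: (split_ordP k) => j ->; case: (split_ordP j) => i ->;
  rewrite slackE !(col_mxEu, col_mxEd) => /subr0_eq h.
- by rewrite mxE hg ?oppr0// inE h eqxx.
- by rewrite hg// inE h eqxx orbT.
- by rewrite mxE he ?oppr0// inE h eqxx.
- by rewrite he// inE h eqxx orbT.
Qed.

(** Binding slacks do not change along [(dsg, u)], and the others leave room for a small step [t] in
    both directions. The cost being linear, optimality against both steps makes it constant, so the
    shifted point is optimal too and uniqueness gives [t *: u = 0]. *)
Lemma unique_optimal_direction f xi sl sg th (dsg : 'cV[R]_nG) u :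
  optimal G f xi sl sg th ->
  (forall sg' th', optimal G f xi sl sg' th' -> th' = th) ->
  (forall v : 'I_(nG + nL), v = 0%N :> nat -> u v 0 = 0) ->
  laplacian G *m u = col_mx dsg 0 ->
  (forall g, g \in binding_gens xi sg -> dsg g 0 = 0) ->
  (forall e, e \in binding_branches G xi th -> flow G u e 0 = 0) ->
  u = 0.
Proof.
move=> [[th0 Lth hgen hflow] opt] uniq u0 Lu dsg0 flow0.
have slack_ge0 : forall k, 0 <= slack G xi sg th k 0 by apply/vle_limits_slack.
have [t t_gt0 ht] := exists_scaling_le slack_ge0
  (slack_shift_binding dsg0 flow0).
have feas (a : R) : `|a| <= t -> feasible G xi sl (sg + a *: dsg) (th + a *: u).
  move=> at_le.
  have /vle_limits_slack[? ?] : forall k,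
      0 <= slack G xi (sg + a *: dsg) (th + a *: u) k 0.
    move=> k; rewrite slackDZ mxE [X in _ + X]mxE.
    (* The slack decreases by at most [|a|] times the size of its shift, which [ht] bounds by the
       slack itself. *)
    rewrite -[_ * _]opprK subr_ge0 (le_trans _ (ht k))//.
    by rewrite (le_trans (ler_norm _))// normrN normrM ler_wpM2r.
  split=> //; first by move=> v v0; rewrite !mxE th0// u0// mulr0 addr0.
  rewrite mulmxDr -scalemxAr Lth Lu scale_col_mx add_col_mx.
  by rewrite scaler0 addr0.
have costE a : cost f (sg + a *: dsg) = cost f sg + a * cost f dsg.
  by rewrite /cost mulmxDr -scalemxAr !mxE.
have fp := feas t; have fm := feas (- t).
rewrite normrN in fm; rewrite gtr0_norm// lexx in fp fm.
have := opt _ _ (fp isT); have := opt _ _ (fm isT).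
rewrite !costE => cm cp.
have c0 : t * cost f dsg = 0 by lra.
have /uniq /eqP : optimal G f xi sl (sg + t *: dsg) (th + t *: u).
  by split=> [|sg' th' /opt]; [exact: fp | rewrite costE c0 addr0].
rewrite -subr_eq0 addrAC subrr add0r scaler_eq0 gt_eqF//=.
by move/eqP.
Qed.

Lemma laplacian_flow u v :
  (laplacian G *m u) v 0 = \sum_e incidence G v e * flow G u e 0.
Proof. by rewrite /laplacian -2!mulmxA mxE /flow -mulmxA. Qed.

Lemma sum_incidence (W : {set 'I_(nG + nL)}) e :
  \sum_(v in W) incidence G v e = (src G e \in W)%:R - (dst G e \in W)%:R.
Proof.
have sum_delta (x : 'I_(nG + nL)) :
    \sum_(v in W) (v == x)%:R = (x \in W)%:R :> R.
  have [xW|xW] := boolP (x \in W).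
    rewrite (bigD1 x)//= eqxx big1 ?addr0// => v /andP[_].
    by move=> /negPf->.
  by apply: big1 => v vW; case: eqP => // vx; rewrite vx (negPf xW) in vW.
by rewrite -!sum_delta -sumrB; apply: eq_bigr => v _; rewrite mxE.
Qed.

(** After exchanging sums, each edge contributes its flow times the difference of the endpoint
    indicators of [V i]. The flow is zero on [S]; any other edge has both endpoints in one block, so
    its indicators cancel. *)
Lemma sum_injection_block (S : {set 'I_nE}) (m : nat)
    (V : 'I_m -> {set 'I_(nG + nL)}) (Es : 'I_m -> {set 'I_nE}) i u :
  partitions_graph G S V Es -> (forall e, e \in S -> flow G u e 0 = 0) ->
  \sum_(v in V i) (laplacian G *m u) v 0 = 0.
Proof.
move=> [[_ disjV] _ inEs coverE] flow0.
under eq_bigr do rewrite laplacian_flow.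
rewrite exchange_big big1//= => e _; rewrite -mulr_suml sum_incidence.
have [eS|eS] := boolP (e \in S); first by rewrite flow0// mulr0.
have : e \in [set: 'I_nE]%SET by rewrite inE.
rewrite -coverE inE (negPf eS) orbF => /bigcupP[j _ /inEs /and3P[sj dj _]].
have [->|ij] := eqVneq i j; first by rewrite sj dj subrr mul0r.
have memNi v : v \in V j -> (v \in V i) = false.
  by apply: contraTF => vi; rewrite (disjointFr (disjV _ _ ij) vi).
by rewrite !memNi// subrr mul0r.
Qed.

End Perturbation.

Theorem lemma2 (R : realType) (nG nL nE : nat) (G : network R nG nL nE)
    (f : 'cV[R]_nG) (tOxi : set (ineq_vec R nG nE))
    (xi : ineq_vec R nG nE) (sl : 'cV[R]_nL)
    (sg : 'cV[R]_nG) (th : 'cV[R]_(nG + nL))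
    (m : nat) (V : 'I_m -> {set 'I_(nG + nL)}) (Es : 'I_m -> {set 'I_nE}) :
  Omega_f G f ->
  is_tilde_Omega_xi G f tOxi -> tOxi xi ->
  tilde_Omega_sl G xi f sl ->
  optimal G f xi sl sg th ->
  partitions_graph G (binding_branches G xi th) V Es ->
  forall i : 'I_m,
    ((lshift nL @: (~: binding_gens xi sg)) :&: V i != finset.set0)%SET.
Proof.
move=> [_ uniq_f] [[tO_sub _] _] tOxi_xi [Osl [sg1 [th1 [opt1 card1]]]] opt part i.
have [[sg2 th2] [[_ uniq2] _]] := uniq_f _ _ (tO_sub _ tOxi_xi) Osl.
have uniq sg' th' : optimal G f xi sl sg' th' -> sg' = sg /\ th' = th.
  move=> opt'; have := uniq2 (sg', th') opt'.
  by rewrite (uniq2 (sg, th) opt) => -[].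
(* By uniqueness, the optimum with [nG - 1] binding constraints is the given one. *)
have [esg eth] := uniq _ _ opt1; rewrite esg eth in card1.
apply/negP => /eqP meet0.
have [[Vn0 _] _ _ _] := part; have /set0Pn[v0 v0V] := Vn0 i.
(* [W] consists of the loads and the binding generators; under the contrary assumption it contains
   [V i]. *)
pose W := (~: (lshift nL @: (~: binding_gens xi sg)))%SET.
have VW v : v \in V i -> v \in W.
  move=> vV; rewrite inE; apply/negP => vU.
  by move/setP/(_ v): meet0; rewrite finset.in_setI vU vV finset.in_set0.
have cardW : #|W| = (#|binding_gens xi sg| + nL)%N.
  rewrite /W cardsCs finset.setCK card_imset; last exact: lshift_inj.
  rewrite [X in (_ - X)%N]cardsCs finset.setCK !card_ord.
  have le_nG : (#|binding_gens xi sg| <= nG)%N.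
    by rewrite -[leqRHS]card_ord max_card.
  by rewrite -addnBAC ?leq_subr// subKn.
(* Dropping [v0] makes up for the reference-angle row, so the size is [#|W|] plus the number of
   binding branches, at most [nL + (nG - 1)]. *)
pose s := [:: \row_v ((v : nat) == 0%N)%:R] ++
  [seq row v (laplacian G) | v <- enum (W :\ v0)%SET] ++
  [seq row e (Bmx G *m (incidence G)^T) | e <- enum (binding_branches G xi th)].
have size_s : (size s < nG + nL)%N.
  rewrite /s !size_cat !size_map -!cardE /= addnA.
  have := cardsD1 v0 W; rewrite VW//= => <-.
  rewrite cardW addnAC ltn_add2r -[X in (_ < X)%N]card1 ltnS.
  exact: card_binding_ge.
have [u u_neq0 su] := exists_common_kernel size_s.
have flow0 e : e \in binding_branches G xi th -> flow G u e 0 = 0.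
  move=> eB; have /su : row e (Bmx G *m (incidence G)^T) \in s.
    by rewrite !mem_cat [X in _ || (_ || X)]map_f ?mem_enum// !orbT.
  by rewrite -row_mul => /matrixP/(_ 0 0); rewrite !mxE.
have L0' v : v \in W -> v != v0 -> (laplacian G *m u) v 0 = 0.
  move=> vW vv0; have /su : row v (laplacian G) \in s.
    by rewrite !mem_cat [X in _ || (X || _)]map_f ?orbT//
       mem_enum finset.in_setD1 vv0.
  by rewrite -row_mul => /matrixP/(_ 0 0); rewrite !mxE.
have L0 v : v \in W -> (laplacian G *m u) v 0 = 0.
  have [->|] := eqVneq v v0; last by move=> ? ?; exact: L0'.
  (* The injection at [v0] is recovered from the zero sum over [V i], whose other terms vanish. *)
  move=> _; have := sum_injection_block i part flow0.
  rewrite (bigD1 v0)//= big1 ?addr0// => w /andP[/VW wW wv0].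
  exact: L0'.
suff : u = 0 by move/eqP; exact/negP.
apply: (unique_optimal_direction opt _ _ _ _ flow0).
- by move=> sg' th' /uniq[].
- move=> v v0E.
  have /su/matrixP/(_ 0 0) : \row_v ((v : nat) == 0%N)%:R \in s.
    by rewrite mem_cat mem_head.
  rewrite !mxE (bigD1 v)//= big1 ?addr0.
    by rewrite mxE v0E mul1r.
  move=> w wv; rewrite mxE -[X in _ == X]v0E.
  by move: wv; rewrite -val_eqE => /negPf->; rewrite mul0r.
(* The generation direction is taken to be the generator block of [laplacian G *m u]; the load block
   is zero since every load lies in [W]. *)
- rewrite -[LHS]vsubmxK; congr col_mx.
  apply/matrixP => l j; rewrite ord1 mxE L0 ?mxE// inE.
  by apply/imsetP => -[g _ /eqP]; rewrite eq_rlshift.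
- move=> g gB; rewrite mxE L0// finset.in_setC finset.mem_imset.
    by rewrite finset.in_setC gB.
  exact: lshift_inj.
Qed.
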